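(* Fix $s\in\{2,3,\dots\}\cup\{\infty\}$ and let $H_n^s$ be equipped with its Haar measure, with coordinate functions $v=(v_{ij})_{i,j=1}^n$. For a string $\varepsilon=(e_1,\dots,e_m)$ of symbols in $\{1,*\}$ put $\mathrm{Tr}_n(\varepsilon):=\mathrm{Tr}(v^{e_1}\cdots v^{e_m})=\sum_{i_1,\dots,i_m}v^{e_1}_{i_1i_2}v^{e_2}_{i_2i_3}\cdots v^{e_m}_{i_mi_1}$. Let $r\in\mathbb N$, $k_1,\dots,k_r\in\mathbb N$, $k=\sum k_i$, let $\gamma\in S_k$ be the trace permutation associated to $k_1,\dots,k_r$, and let $\varepsilon_1,\dots,\varepsilon_r$ be strings of lengths $k_1,\dots,k_r$. Then, as $n\to\infty$, the joint moments of the variables $\mathrm{Tr}_n(\varepsilon)$ converge, and for the limiting variables $v(\varepsilon)=\lim_{n\to\infty}\mathrm{Tr}_n(\varepsilon)$ the classical cumulants are $$c_r(v(\varepsilon_1),\dots,v(\varepsilon_r))=\#\{p\in P^s(\varepsilon_1\cdots\varepsilon_r) : p\vee\gamma=1_k,\ p=\gamma(p)\},$$ where $\varepsilon_1\cdots\varepsilon_r$ is the concatenation of the strings.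
   Context: $H_n^s=\mathbb Z_s\wr S_n$ is the group of $n\times n$ monomial matrices whose nonzero entries are $s$-th roots of unity; for $s=\infty$, the nonzero entries are arbitrary complex numbers of modulus $1$. $v^1_{ij}=v_{ij}$ and $v^*_{ij}=\overline{v_{ij}}$ (entrywise complex conjugate). For a string $\varepsilon=(e_1,\dots,e_k)$, $P^s(\varepsilon)$ is the set of partitions of $\{1,\dots,k\}$ such that in each block the number of positions $j$ with $e_j=1$ equals the number of positions with $e_j=*$ modulo $s$ (for $s=\infty$: exactly equal). The trace permutation $\gamma$ has cycles $(1,\dots,k_1)$, $(k_1+1,\dots,k_1+k_2)$, $\dots$, $(k-k_r+1,\dots,k)$; it is also viewed as the partition into its cycles; $\gamma(p)$ is the partition with blocks $\gamma(B)$, $B\in p$; $1_k$ is the one-block partition; $\vee$ is the join. Classical cumulants $c_r$ are the multilinear functionals defined by the moment-cumulant formula over all partitions. *)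

(* Defs.v *)
From HB Require Import structures.
From mathcomp Require Import all_boot all_order all_algebra all_fingroup.
From mathcomp Require Import all_classical all_reals all_analysis.
From mathcomp Require Import complex.
Set Implicit Arguments. Unset Strict Implicit. Unset Printing Implicit Defensive.
Import Order.TTheory GRing.Theory Num.Theory numFieldNormedType.Exports.
Local Open Scope ring_scope.
Local Open Scope complex_scope.

Inductive sparam := SFin of nat | SInf.

Definition sparam_ok (s : sparam) : bool :=
  if s is SFin m then (2 <= m)%N else true.

Definition eqmod_s (s : sparam) (a b : nat) : bool :=
  if s is SFin m then (a == b %[mod m])%N else (a == b)%N.

(* Strings of symbols in {1,*} : true stands for 1, false stands for *.     *)

Section Haar.
Variable R : realType.
Local Notation C := R[i].

Definition Cint01 (h : R -> C) : C :=
  (Rintegral (@lebesgue_measure R) `[0%R, 1%R]%classic (fun t => complex.Re (h t)))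
  +i* (Rintegral (@lebesgue_measure R) `[0%R, 1%R]%classic (fun t => complex.Im (h t))).

Definition expi2pi (x : R) : C := cos (2 * pi * x) +i* sin (2 * pi * x).

Fixpoint int_coords (n : nat) (l : seq 'I_n) (G : ('I_n -> R) -> C)
    (th : 'I_n -> R) : C :=
  match l with
  | [::] => G th
  | i :: l' => Cint01 (fun t => int_coords l' G (fun j => if j == i then t else th j))
  end.

(* Expectation w.r.t. the Haar (probability) measure of the group Z_s^n     *)
(* (s finite, realised as s-th roots of unity) resp. of the torus T^n.      *)
Definition torusE (s : sparam) (n : nat) (F : ('I_n -> C) -> C) : C :=
  match s with
  | SFin m => ((m ^ n)%N%:R)^-1 *
      \sum_(f : {ffun 'I_n -> 'I_m}) F (fun i => expi2pi ((f i)%:R / m%:R))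
  | SInf => int_coords (enum 'I_n) (fun th => F (fun i => expi2pi (th i)))
                       (fun _ => 0)
  end.

(* The monomial matrix D_z P_sigma: entry (i,j) is z_i if sigma j = i, else 0.
   Every element of H_n^s = Z_s wr S_n is uniquely of this form. *)
Definition monomial_mx (n : nat) (sg : 'S_n) (z : 'I_n -> C) : 'M[C]_n :=
  \matrix_(i, j) (if sg j == i then z i else 0).

(* Expectation w.r.t. the Haar probability measure of H_n^s, which is the
   product of the uniform measure on S_n and the Haar measure of Z_s^n. *)
Definition haarE (s : sparam) (n : nat) (F : 'M[C]_n -> C) : C :=
  ((n`!)%:R)^-1 * \sum_(sg : 'S_n) torusE s (fun z => F (monomial_mx sg z)).

Definition vpow (n : nat) (U : 'M[C]_n) (e : bool) : 'M[C]_n :=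
  if e then U else map_mx conjc U.

Definition TrW (n : nat) (eps : seq bool) (U : 'M[C]_n) : C :=
  \tr (foldr (fun e A => vpow U e *m A) 1%:M eps).

Definition moment (s : sparam) (n : nat) (l : seq (seq bool)) : C :=
  haarE s (fun U : 'M[C]_n => \prod_(e <- l) TrW e U).

Definition cvgR (u : nat -> R) (a : R) : Prop := (u @ \oo --> a)%classic.
Definition cvgC (u : nat -> C) (a : C) : Prop :=
  cvgR (fun n => complex.Re (u n)) (complex.Re a) /\
  cvgR (fun n => complex.Im (u n)) (complex.Im a).

(* Classical cumulants, defined by the moment-cumulant formula
     m(X_1..X_r) = sum_{pi in P(r)} prod_{B in pi} c_{|B|}(X_B),
   i.e. c(X_1..X_r) = m(X_1..X_r) - sum_{pi <> 1_r} prod_{B in pi} c(X_B).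
   The argument f is fuel (= the length of the list). *)
Definition subl (X : Type) (l : seq X) (B : {set 'I_(size l)}) : seq X :=
  [seq tnth (in_tuple l) i | i <- enum B].

Fixpoint cum_aux (X : Type) (m : seq X -> C) (f : nat) (l : seq X) : C :=
  match f with
  | 0 => 0
  | f'.+1 => m l -
      \sum_(P : {set {set 'I_(size l)}} |
              finset.partition P [set: 'I_(size l)] && (P != [set [set: 'I_(size l)]]))
        \prod_(B in P) cum_aux m f' (subl B)
  end.

Definition cumulant (X : Type) (m : seq X -> C) (l : seq X) : C :=
  cum_aux m (size l) l.

End Haar.

Definition in_Ps (s : sparam) (w : seq bool) (p : {set {set 'I_(size w)}}) : bool :=
  [forall B in p, eqmod_s s #|[set i in B | nth false w i]|
                            #|[set i in B | ~~ nth false w i]|].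

Definition one_part (k : nat) : {set {set 'I_k}} := [set [set: 'I_k]].

Definition cycle_part (k : nat) (g : 'I_k -> 'I_k) : {set {set 'I_k}} :=
  equivalence_partition (fconnect g) [set: 'I_k].

Definition same_block (k : nat) (P : {set {set 'I_k}}) (x y : 'I_k) : bool :=
  [exists B in P, (x \in B) && (y \in B)].

Definition pjoin (k : nat) (P Q : {set {set 'I_k}}) : {set {set 'I_k}} :=
  equivalence_partition
    (connect (fun x y => same_block P x y || same_block Q x y)) [set: 'I_k].

Definition perm_part (k : nat) (g : 'I_k -> 'I_k) (p : {set {set 'I_k}}) :=
  [set [set g x | x in B] | B : {set 'I_k} in p].

(* The trace permutation associated to k_1,...,k_r (list ks), on positions
   0,...,k-1 (0-based): cycles (0..k_1-1)(k_1..k_1+k_2-1)... *)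
Fixpoint gamma_nat (ks : seq nat) (off i : nat) : nat :=
  match ks with
  | [::] => i
  | a :: ks' => if (i < off + a)%N then (if (i.+1 == off + a)%N then off else i.+1)
                else gamma_nat ks' (off + a) i
  end.

Definition gamma (strs : seq (seq bool)) (i : 'I_(size (flatten strs)))
  : 'I_(size (flatten strs)) :=
  insubd i (gamma_nat (map size strs) 0 i).

Definition count_parts (s : sparam) (strs : seq (seq bool)) : nat :=
  let w := flatten strs in
  #|[set p : {set {set 'I_(size w)}} |
      [&& finset.partition p [set: 'I_(size w)], in_Ps s p,
          (pjoin p (cycle_part (@gamma strs)) == one_part (size w)) &
          (perm_part (@gamma strs) p == p)]]|.

(* Main.v *)
Require Import Defs.
From HB Require Import structures.
From mathcomp Require Import all_boot all_order all_algebra all_fingroup.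
Set Implicit Arguments. Unset Strict Implicit. Unset Printing Implicit Defensive.

(* Expanding the traces, a joint moment is a sum over maps f from the k
   positions to {1,...,n}: the average over the roots of unity keeps f iff the
   kernel p of f is balanced modulo s, and the average over S_n is the
   probability that sigma o f o gamma = f.  The latter is impossible unless
   gamma(p) = p; and if gamma(p) = p, the maps with kernel p (which exist when
   n >= k) form one S_n-orbit, so their probabilities add up to 1.  Hence for
   n >= k the moment is exactly #{p in P^s : gamma(p) = p}.
   Sorting these p by the partition p v gamma, read as a partition of the set
   of strings, and cutting p along its blocks turns this count into
   sum_P prod_(B in P) (connected count of the strings in B), which is the
   moment-cumulant formula; it determines the cumulants recursively. *)

(** * Stable partitions and their decomposition along p v gamma *)

Section StablePartitions.
Variables (X : finType) (g : X -> X) (Bal : pred {set X}).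

(** [Bal] stands for the balance condition modulo s. For injective [g] the last clause amounts to
    [g(p) = p], because taking images of blocks is then injective on the finite set [p]. *)
Definition stable_partition (A : {set X}) (p : {set {set X}}) : bool :=
  [&& partition p A, [forall b in p, Bal b] & [forall b in p, g @: b \in p]].

(* Says that the join of p with the orbits of g is the one-block partition of A:
   no proper nonempty subset is both g-stable and a union of blocks of p. *)
Definition connected_partition (A : {set X}) (p : {set {set X}}) : bool :=
  [forall S : {set X},
     [&& S \subset A, S != set0, g @: S \subset S &
         [forall b in p, ~~ [disjoint b & S] ==> (b \subset S)]] ==> (S == A)].

Lemma connected_partitionP (A : {set X}) (p : {set {set X}}) :
  reflect (forall S : {set X}, S \subset A -> S != set0 ->
             {in S, forall x, g x \in S} ->
             {in p, forall (b : {set X}) x, x \in b -> x \in S -> b \subset S} -> S = A)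
          (connected_partition A p).
Proof.
apply: (iffP forallP) => [H S SA S0 gS pS | H S].
  apply/eqP/(implyP (H S)); rewrite SA S0 /=; apply/andP; split.
    by apply/subsetP => _ /imsetP[x xS ->]; apply: gS.
  apply/'forall_implyP => b bp; apply/implyP => /pred0Pn[x /=/andP[xb xS]].
  exact: pS xS.
apply/implyP => /and4P[SA S0 gS /'forall_implyP pS].
apply/eqP/H => // [x xS|b bp x xb xS].
  by apply: (subsetP gS); apply: imset_f.
by apply: (implyP (pS _ bp)); apply/pred0Pn; exists x; rewrite /= xb xS.
Qed.

Definition stable_count (A : {set X}) := #|[set p | stable_partition A p]|.
Definition connected_count (A : {set X}) :=
  #|[set p | stable_partition A p && connected_partition A p]|.

Lemma partitionW (p : {set {set X}}) (A : {set X}) :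
  set0 \notin p -> (forall b, b \in p -> b \subset A) ->
  (forall x, x \in A -> exists2 b, b \in p & x \in b) ->
  (forall b b' x, b \in p -> b' \in p -> x \in b -> x \in b' -> b = b') ->
  partition p A.
Proof.
move=> p0 sub cov tri; apply/and3P; split => //.
  rewrite eqEsubset; apply/andP; split; first exact/bigcupsP.
  by apply/subsetP => x /cov[b bp xb]; apply/bigcupP; exists b.
apply/trivIsetP => b b' bp b'p; apply: contra_neqT => /pred0Pn[x /= /andP[xb xb']].
exact: tri xb xb'.
Qed.

End StablePartitions.

Section Decomposition.
Variables (X I : finType) (g : X -> X) (Bal : pred {set X}) (pr : X -> I).
(** [X] plays the role of the positions and [I] that of the strings. Together [pr_g] and [pr_fiber]
    say that the fibres of [pr] are exactly the orbits of [g]. *)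
Hypothesis pr_surj : forall i, exists x, pr x = i.
Hypothesis pr_g : forall x, pr (g x) = pr x.
Hypothesis pr_fiber : forall (S : {set X}) x y,
  {in S, forall z, g z \in S} -> x \in S -> pr x = pr y -> y \in S.

Local Notation fib B := (pr @^-1: B).

Definition touch (p : {set {set X}}) (i j : I) : bool :=
  [exists b in p, (i \in pr @: b) && (j \in pr @: b)].

(** This is the join of [p] with the orbits of [g], read on orbit indices: [touch] links two orbits
    when one block of [p] meets both. *)
Definition index_partition (p : {set {set X}}) : {set {set I}} :=
  equivalence_partition (connect (touch p)) [set: I].

Definition glue (P : {set {set I}}) (f : {ffun {set I} -> {set {set X}}}) :
  {set {set X}} := \bigcup_(B in P) f B.

Definition pieces (B : {set I}) : {set {set {set X}}} :=
  [set q | stable_partition g Bal (fib B) q && connected_partition g (fib B) q].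

Lemma connect_touch_equiv p : equivalence_rel (connect (touch p)).
Proof.
apply/equivalence_relP; split=> [x|x y xy z]; first exact: connect0.
have sym : connect_sym (touch p).
  by apply: sym_connect_sym => i j; apply: eq_existsb => b; rewrite [X in _ && X]andbC.
apply/idP/idP => H; last exact: connect_trans xy H.
by rewrite sym in xy; apply: connect_trans xy H.
Qed.

Lemma index_partitionP p : partition (index_partition p) [set: I].
Proof. by apply: equivalence_partitionP => ? ? ? _ _ _; apply: connect_touch_equiv. Qed.

Lemma mem_index_partition p B i j : B \in index_partition p -> i \in B ->
  (j \in B) = connect (touch p) i j.
Proof.
move=> BP iB; have PP := index_partitionP p.
rewrite -(def_pblock (partition_trivIset PP) BP iB).
by rewrite pblock_equivalence_partition ?inE // => ? ? ? _ _ _; apply: connect_touch_equiv.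
Qed.

Section Fixed.
Variable P : {set {set I}}.
Hypothesis PP : partition P [set: I].

Let blockE B B' i : B \in P -> B' \in P -> i \in B -> i \in B' -> B = B'.
Proof.
move=> BP B'P iB iB'; have tP := partition_trivIset PP.
by rewrite -(def_pblock tP BP iB) (def_pblock tP B'P iB').
Qed.

Let blockX i : exists2 B, B \in P & i \in B.
Proof.
have: i \in cover P by rewrite (cover_partition PP).
by case/bigcupP => B; exists B.
Qed.

Section Glue.
Variable f : {ffun {set I} -> {set {set X}}}.
Hypothesis fP : forall B, B \in P -> f B \in pieces B.

Let fB B : B \in P -> [/\ partition (f B) (fib B), {in f B, forall b, Bal b},
  {in f B, forall b : {set X}, g @: b \in f B} & connected_partition g (fib B) (f B)].
Proof.
move=> /fP; rewrite inE => /andP[/and3P[? /'forall_implyP ? /'forall_implyP ?] ?].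
by split.
Qed.

Let memf B b x : B \in P -> b \in f B -> x \in b -> pr x \in B.
Proof.
move=> /fB[pB _ _ _] bf xb.
by have /subsetP/(_ x xb) := partitionS pB bf; rewrite inE.
Qed.

Lemma glue_stable : stable_partition g Bal [set: X] (glue P f).
Proof.
apply/and3P; split.
- apply: partitionW => [|b _|x _|b b' x].
  + apply/bigcupP => -[B /fB[pB _ _ _]].
    by rewrite (finset.partition0 pB).
  + exact: subsetT.
  + have [B BP xB] := blockX (pr x); have [pB _ _ _] := fB BP.
    have: x \in cover (f B) by rewrite (cover_partition pB) inE.
    by case/bigcupP => b bf xb; exists b => //; apply/bigcupP; exists B.
  + move=> /bigcupP[B BP bf] /bigcupP[B' B'P b'f] xb xb'.
    have E : B = B' by apply: blockE (memf BP bf xb) (memf B'P b'f xb').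
    rewrite -E in b'f; have [pB _ _ _] := fB BP.
    have tP := partition_trivIset pB.
    by rewrite -(def_pblock tP bf xb) (def_pblock tP b'f xb').
- apply/'forall_implyP => b /bigcupP[B BP bf].
  by have [_ + _ _] := fB BP; apply.
- apply/'forall_implyP => b /bigcupP[B BP bf]; apply/bigcupP; exists B => //.
  by have [_ _ + _] := fB BP; apply.
Qed.

(** A block of the glued partition comes from a single [f B'] and so lies over a single block of
    [P]; hence no [touch] step crosses the border of [B]. *)
Lemma touch_glue_block B i j : B \in P -> i \in B -> connect (touch (glue P f)) i j ->
  j \in B.
Proof.
move=> BP iB; move/(@closed_connect _ _ (mem B)) => <- // {i iB j}.
move=> i j /existsP[b /and3P[/bigcupP[B' B'P bf] /imsetP[x xb ->] /imsetP[y yb ->]]].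
have xB := memf B'P bf xb; have yB := memf B'P bf yb.
apply/idP/idP => H.
  by rewrite (blockE BP B'P H xB).
by rewrite (blockE BP B'P H yB).
Qed.

(** The points of [fib B] whose index is reachable from [i] form a nonempty [g]-stable union of
    blocks of [f B], so connectedness of [f B] makes them fill [fib B]. *)
Lemma block_touch_glue B i j : B \in P -> i \in B -> j \in B ->
  connect (touch (glue P f)) i j.
Proof.
move=> BP iB jB; have [pB _ _ /connected_partitionP cB] := fB BP.
have [y yj] := pr_surj j; have [x xi] := pr_surj i.
pose S := [set z in fib B | connect (touch (glue P f)) i (pr z)].
suff SB : S = fib B.
  by have : y \in S by [rewrite SB inE yj]; rewrite !inE yj => /andP[].
apply: cB.
- by apply/subsetP => z; rewrite inE => /andP[].
- by apply/set0Pn; exists x; rewrite !inE xi iB connect0.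
- by move=> z; rewrite !inE pr_g.
- move=> b bf u ub; rewrite inE => /andP[uB iu]; apply/subsetP => v vb.
  rewrite !inE (memf BP bf vb) /=; apply: connect_trans iu (connect1 _).
  apply/existsP; exists b; rewrite !imset_f // !andbT.
  by apply/bigcupP; exists B.
Qed.

Lemma index_partition_glue : index_partition (glue P f) = P.
Proof.
rewrite /index_partition -[RHS](equivalence_partition_pblock PP).
suff E : connect (touch (glue P f)) =2 fun x y => y \in pblock P x.
  by apply: eq_imset => x; apply/setP => y; rewrite !inE E.
move=> i j; have [B BP iB] := blockX i.
rewrite (def_pblock (partition_trivIset PP) BP iB); apply/idP/idP.
  exact: touch_glue_block.
exact: block_touch_glue.
Qed.

Lemma glueK B : B \in P -> [set b in glue P f | b \subset fib B] = f B.
Proof.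
move=> BP; have [pB _ _ _] := fB BP; apply/setP => b; rewrite inE.
apply/andP/idP => [[/bigcupP[B' B'P bf] /subsetP bB]|bf]; last first.
  by split; [apply/bigcupP; exists B | apply: partitionS pB bf].
have [pB' _ _ _] := fB B'P.
have /set0Pn[x xb] := partition_neq0 pB' bf.
have := bB _ xb; rewrite inE => xB.
by rewrite (blockE BP B'P xB (memf B'P bf xb)).
Qed.

End Glue.

Section Split.
Variable p : {set {set X}}.
Hypothesis ps : stable_partition g Bal [set: X] p.
Hypothesis pP : index_partition p = P.

Let pb : partition p [set: X].
Proof. by case/and3P: ps. Qed.

Let subfib b x B : b \in p -> x \in b -> B \in P -> pr x \in B -> b \subset fib B.
Proof.
move=> bp xb; rewrite -pP => BP xB; apply/subsetP => y yb; rewrite inE.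
rewrite (mem_index_partition _ BP xB); apply: connect1.
by apply/existsP; exists b; rewrite bp !imset_f.
Qed.

Lemma split_piece B : B \in P -> [set b in p | b \subset fib B] \in pieces B.
Proof.
move=> BP; case/and3P: (ps) => _ /'forall_implyP balp /'forall_implyP gp.
have cov x : exists2 b, b \in p & x \in b.
  have: x \in cover p by rewrite (cover_partition pb).
  by case/bigcupP=> b; exists b.
rewrite inE; apply/andP; split; first (apply/and3P; split).
- apply: partitionW => [|b|x|b b' x].
  + by rewrite inE (finset.partition0 pb).
  + by rewrite inE => /andP[].
  + rewrite inE => xB; have [b bp xb] := cov x.
    by exists b => //; rewrite inE bp (subfib bp xb BP xB).
  + rewrite !inE => /andP[bp _] /andP[b'p _] xb xb'.
    have tP := partition_trivIset pb.
    by rewrite -(def_pblock tP bp xb) (def_pblock tP b'p xb').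
- by apply/'forall_implyP => b; rewrite inE => /andP[/balp].
- apply/'forall_implyP => b; rewrite !inE => /andP[/gp -> /subsetP bB] /=.
  by apply/subsetP => _ /imsetP[x xb ->]; have := bB _ xb; rewrite !inE pr_g.
apply/connected_partitionP => S SB /set0Pn[x xS] gS pS; apply/eqP.
rewrite eqEsubset SB /=; apply/subsetP => y; rewrite inE => yB.
have xB : pr x \in B by have := subsetP SB x xS; rewrite inE.
(* By [pr_fiber] the [g]-stable set [S] is a union of whole fibres. Being also a union of blocks, it
   projects to a set closed under [touch]; since [B] is one [touch] class, [S] is all of [fib B]. *)
have clS : closed (touch p) (mem (pr @: S)).
  apply: intro_closed.
    by apply: sym_connect_sym => i j; apply: eq_existsb => b; rewrite [X in _ && X]andbC.
  move=> i j /existsP[b /and3P[bp /imsetP[u ub ->] /imsetP[v vb ->]]].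
  case/imsetP => w wS uw; have uS := pr_fiber gS wS (esym uw).
  apply/imsetP; exists v => //; apply: (subsetP (pS b _ u ub uS)) => //.
  rewrite inE bp /= (subfib bp ub BP) //.
  by have := subsetP SB u uS; rewrite inE.
move: (yB); rewrite -pP in BP; rewrite (mem_index_partition _ BP xB).
move/(closed_connect clS); rewrite [LHS]imset_f // => /esym /imsetP[z zS yz].
exact: pr_fiber gS zS (esym yz).
Qed.

Lemma splitK :
  glue P [ffun B => if B \in P then [set b in p | b \subset fib B] else set0] = p.
Proof.
apply/setP => b; apply/bigcupP/idP => [[B BP]|bp].
  by rewrite ffunE BP inE => /andP[].
have /set0Pn[x xb] := partition_neq0 pb bp.
have [B BP xB] := blockX (pr x); exists B => //.
by rewrite ffunE BP inE bp (subfib bp xb BP xB).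
Qed.

End Split.

(** Gluing is a bijection from families of connected pieces, one for each [B] in [P], onto the
    partitions with index partition [P]; its inverse cuts [p] along the sets [fib B]. The default
    [set0] outside [P] makes the family unique as a finite function. *)
Lemma card_index_partition :
  #|[set p | stable_partition g Bal [set: X] p && (index_partition p == P)]| =
  \prod_(B in P) connected_count g Bal (fib B).
Proof.
have -> : \prod_(B in P) connected_count g Bal (fib B) =
    #|pfamily set0 (mem P) (fun B => mem (pieces B))|.
  by rewrite card_pfamily foldrE big_map big_enum.
rewrite -(card_in_imset (f := glue P)); last first.
  move=> f f' /pfamilyP[fs fP] /pfamilyP[f's f'P] E; apply/ffunP => B.
  case BP: (B \in P); first by rewrite -(glueK fP BP) -(glueK f'P BP) E.
  rewrite (supportP fs) ?BP // (supportP f's) ?BP //.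
apply: eq_card => p; rewrite inE; apply/andP/imsetP => [[ps /eqP pP]|[f /pfamilyP[_ fP] ->]].
  exists [ffun B => if B \in P then [set b in p | b \subset fib B] else set0].
    apply/pfamilyP; split => [|B BP].
      by apply/supportP => B; rewrite ffunE => /negPf->.
    by rewrite ffunE BP; apply: split_piece.
  by rewrite splitK.
by rewrite glue_stable // index_partition_glue.
Qed.

End Fixed.

Lemma stable_count_sum :
  stable_count g Bal [set: X] =
  \sum_(P | partition P [set: I]) \prod_(B in P) connected_count g Bal (fib B).
Proof.
rewrite /stable_count -sum1_card.
rewrite (partition_big index_partition (fun P => partition P [set: I])) /=; last first.
  by move=> p _; apply: index_partitionP.
apply: eq_bigr => P PP; rewrite -card_index_partition // sum1dep_card.
by apply: eq_card => p; rewrite !inE.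
Qed.

End Decomposition.

(** * Invariance of the counts under equivariant injections *)

Section Transport.
Variables (X X' : finType) (h : X' -> X) (g : X -> X) (g' : X' -> X').
Variables (Bal : pred {set X}) (Bal' : pred {set X'}).
Hypothesis h_inj : injective h.
Hypothesis h_g : forall x, h (g' x) = g (h x).
Hypothesis h_Bal : forall b : {set X'}, Bal (h @: b) = Bal' b.

Let hI := imset_inj h_inj.

Lemma stable_partition_imset (A : {set X'}) (p : {set {set X'}}) :
  stable_partition g Bal (h @: A) [set h @: b | b : {set X'} in p] =
  stable_partition g' Bal' A p.
Proof.
rewrite /stable_partition imset_partition //; congr [&& _, _ & _].
  apply/'forall_implyP/'forall_implyP => H b.
    by move=> bp; rewrite -h_Bal; apply: H; apply: imset_f.
  by move=> /imsetP[c cp ->]; rewrite h_Bal; apply: H.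
have gh (b : {set X'}) : g @: (h @: b) = h @: (g' @: b).
  by rewrite -!imset_comp; apply: eq_imset => x /=.
apply/'forall_implyP/'forall_implyP => H b.
  by move=> bp; have := H (h @: b) (imset_f _ bp); rewrite gh mem_imset.
by move=> /imsetP[c cp ->]; rewrite gh mem_imset //; apply: H.
Qed.

Lemma connected_partition_imset (A : {set X'}) (p : {set {set X'}}) :
  connected_partition g (h @: A) [set h @: b | b : {set X'} in p] = connected_partition g' A p.
Proof.
apply/connected_partitionP/connected_partitionP => H S SA S0 gS pS.
  apply: hI; apply: H.
  - exact: imsetS.
  - by case/set0Pn: S0 => x xS; apply/set0Pn; exists (h x); apply: imset_f.
  - by move=> _ /imsetP[x xS ->]; rewrite -h_g; apply/imset_f/gS.
  - move=> _ /imsetP[c cp ->] _ /imsetP[x xc ->]; rewrite mem_imset // => xS.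
    by apply: imsetS; apply: pS xS.
have SE : S = h @: (h @^-1: S).
  apply/setP => x; apply/idP/imsetP => [xS|[y + ->]]; last by rewrite inE.
  by have /imsetP[y _ E] := subsetP SA x xS; exists y; rewrite // inE -E.
rewrite SE; suff -> : h @^-1: S = A by []; apply: H.
- by apply/subsetP => x; rewrite inE => /(subsetP SA); rewrite mem_imset.
- by apply: contraNneq S0 => S0; rewrite SE S0 imset0.
- by move=> x; rewrite !inE h_g; apply: gS.
- move=> b bp x xb; rewrite inE => xS; apply/subsetP => y yb; rewrite inE.
  have /subsetP := pS _ (imset_f _ bp) _ (imset_f _ xb) xS.
  by apply; apply: imset_f.
Qed.

Lemma connected_count_imset (A : {set X'}) :
  connected_count g Bal (h @: A) = connected_count g' Bal' A.
Proof.
rewrite /connected_count -[RHS](card_imset _ (imset_inj hI)); apply: eq_card => p.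
rewrite inE; apply/idP/imsetP => [pA|[q qA ->]]; last first.
  by rewrite stable_partition_imset connected_partition_imset; rewrite inE in qA.
have /andP[/and3P[pp _ _] _] := pA.
(* Blocks of [p] lie in the image of [h], so each is the image of its own preimage; this inverts the
   passage from partitions of [A] to partitions of [h @: A]. *)
have pE : p = [set h @: b | b : {set X'} in [set h @^-1: c | c : {set X} in p]].
  rewrite -imset_comp -[LHS]imset_id; apply: eq_in_imset => b bp /=.
  apply/setP => x; apply/idP/imsetP => [xb|[y + ->]]; last by rewrite inE.
  have /imsetP[y _ E] := subsetP (partitionS pp bp) x xb.
  by exists y; rewrite // inE -E.
exists [set h @^-1: c | c : {set X} in p] => //.
by rewrite inE -stable_partition_imset -connected_partition_imset -pE.
Qed.

End Transport.

(** * Permutations solving sigma o f o gamma = f *)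

Section PermCount.
Variables (X Y : finType) (g : X -> X) (Bal : pred {set X}).
Hypothesis g_inj : injective g.

Implicit Types (x y z : X) (f : {ffun X -> Y}) (b : {set X}).

(** Take [t] with [t (u x) = v x] at as many points as possible. If this fails at [x0], composing
    [t] with the transposition of [t (u x0)] and [v x0] repairs [x0] and, as [u] and [v] identify
    the same points, spoils no other agreement. *)
Lemma perm_extend (u v : X -> Y) : (forall x y, (u x == u y) = (v x == v y)) ->
  exists t : {perm Y}, forall x, t (u x) = v x.
Proof.
move=> uv; pose agree (t : {perm Y}) := [set x | t (u x) == v x].
have [t _ tmax] := @arg_maxnP _ 1%g xpredT (fun t => #|agree t|) isT.
exists t => x0; apply: contraTeq isT => /eqP ne.
have := tmax (t * tperm (t (u x0)) (v x0))%g isT; rewrite /= leqNgt => /negP[].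
apply: proper_card; apply/properP; split; last first.
  by exists x0; rewrite !inE ?permM ?tpermL //; apply/eqP.
apply/subsetP => x; rewrite !inE permM => /eqP tx.
have nx : u x != u x0.
  by apply: contra_notN ne => xx0; have := xx0; rewrite uv -(eqP xx0) tx => /eqP.
rewrite tpermD ?tx // eq_sym ?(inj_eq perm_inj) //.
  by rewrite -tx (inj_eq perm_inj).
by rewrite -uv.
Qed.

Definition fibers (f : {ffun X -> Y}) : {set {set X}} := preim_partition f [set: X].

Let fibers_equiv (f : {ffun X -> Y}) :
  {in [set: X] & &, equivalence_rel (fun x y => f x == f y)}.
Proof. by move=> x y z _ _ _; split=> // /eqP->. Qed.

Lemma fibersP f : partition (fibers f) [set: X].
Proof. exact: preim_partitionP. Qed.

Lemma mem_fibers f b x y : b \in fibers f -> x \in b -> (y \in b) = (f x == f y).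
Proof.
move=> bk xb; rewrite -(def_pblock (partition_trivIset (fibersP f)) bk xb).
by rewrite (pblock_equivalence_partition (@fibers_equiv f)) ?inE.
Qed.

Lemma fibers_block f x : [set y | f x == f y] \in fibers f.
Proof.
have: x \in cover (fibers f) by rewrite (cover_partition (fibersP f)) inE.
case/bigcupP => b bk xb; suff -> : [set y | f x == f y] = b by [].
by apply/setP => y; rewrite inE (mem_fibers _ bk xb).
Qed.

Lemma fibers_eqP f f' : (forall x y, (f x == f y) = (f' x == f' y)) <-> fibers f = fibers f'.
Proof.
split=> [ff'|E x y].
  apply/setP => b; apply/idP/idP => bk.
    have /set0Pn[x xb] := partition_neq0 (fibersP _) bk.
    suff -> : b = [set y | f' x == f' y] by exact: fibers_block.
    by apply/setP => y; rewrite inE -ff' (mem_fibers _ bk xb).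
  have /set0Pn[x xb] := partition_neq0 (fibersP _) bk.
  suff -> : b = [set y | f x == f y] by exact: fibers_block.
  by apply/setP => y; rewrite inE ff' (mem_fibers _ bk xb).
have bk := fibers_block f x; have xb : x \in [set y | f x == f y] by rewrite inE.
by rewrite E in bk; rewrite -(mem_fibers y bk xb) inE.
Qed.

Lemma fibers_stableP f :
  reflect (forall x y, (f (g x) == f (g y)) = (f x == f y))
          [forall b in fibers f, g @: b \in fibers f].
Proof.
apply: (iffP 'forall_implyP) => [H x y|H b bk].
  have bk := fibers_block f x; have bk' := fibers_block f y.
  have xb : x \in [set z | f x == f z] by rewrite inE.
  have yb : y \in [set z | f y == f z] by rewrite inE.
  have gbk := H _ bk; rewrite -(mem_fibers _ gbk (imset_f g xb)).
  by rewrite (mem_imset _ _ g_inj) (mem_fibers y bk xb).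
have /set0Pn[x xb] := partition_neq0 (fibersP _) bk.
suff -> : g @: b = [set z | f (g x) == f z] by exact: fibers_block.
apply/setP => z; rewrite inE -[z](f_invF g_inj) mem_imset // H.
by rewrite (mem_fibers _ bk xb).
Qed.

Lemma fibers_surj (p : {set {set X}}) : #|X| <= #|Y| -> partition p [set: X] ->
  exists f, fibers f = p.
Proof.
move=> XY pp; pose e (x : X) : Y := enum_val (widen_ord XY (enum_rank x)).
have e_inj : injective e.
  by move=> x y /enum_val_inj /(congr1 val) /= /val_inj /enum_rank_inj.
(* [r] picks a representative through the block [pblock p x] alone, so it is constant on blocks and
   separates them. The default [x] never occurs, since every block is inhabited. *)
pose r x := odflt x [pick y in pblock p x].
have cov x : x \in cover p by rewrite (cover_partition pp) inE.
have tp := partition_trivIset pp.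
have rb x : r x \in pblock p x.
  by rewrite /r; case: pickP => //= /(_ x); rewrite mem_pblock cov.
have rE x y : (r x == r y) = (y \in pblock p x).
  apply/eqP/idP => [E|].
    rewrite -eq_pblock //; apply/eqP.
    by rewrite -(same_pblock tp (rb x)) E (same_pblock tp (rb y)).
  move=> yx; have E := same_pblock tp yx.
  rewrite /r E; case: pickP => //= /(_ x).
  by rewrite mem_pblock cov.
exists [ffun x => e (r x)].
rewrite -[RHS](equivalence_partition_pblock pp) /fibers /preim_partition.
apply: eq_imset => x; apply/setP => y.
by rewrite !inE !ffunE (inj_eq e_inj) rE.
Qed.

Definition perm_sols (f : {ffun X -> Y}) : {set {perm Y}} :=
  [set t : {perm Y} | [forall x, t (f (g x)) == f x]].

(** A solution [t] is injective and carries [f (g x)] to [f x], so [f] after [g] and [f] identify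
    the same points, which is stability of the fibers. *)
Lemma perm_sols0 f : ~~ [forall b in fibers f, g @: b \in fibers f] -> perm_sols f = set0.
Proof.
apply: contraNeq => /set0Pn[t]; rewrite inE => /forallP tf.
apply/fibers_stableP => x y.
by rewrite -(eqP (tf x)) -(eqP (tf y)) (inj_eq perm_inj).
Qed.

(* All maps with the same fibers are translates of one of them by permutations,
   so each permutation of Y is counted once. *)
Lemma sum_perm_sols f0 : [forall b in fibers f0, g @: b \in fibers f0] ->
  \sum_(f | fibers f == fibers f0) #|perm_sols f| = #|Y|`!.
Proof.
move=> st0; have solsE f : fibers f == fibers f0 ->
    #|perm_sols f| = \sum_(t : {perm Y} | f == [ffun x => t (f0 x)]) 1.
  move=> /eqP kf; have /fibers_stableP stf := st0.
  (* With [t (f0 x) = f (g x)], a permutation [u] solves the equation for [f] iff [f] is [t * u]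
     applied after [f0]. Left multiplication by [t] thus matches the solutions with the translations
     taking [f0] to [f]. *)
  have [x y|t tE] := @perm_extend f0 (fun x => f (g x)).
    by rewrite (iffRL (fibers_eqP f f0) kf) stf.
  rewrite sum1dep_card -[LHS](card_imset _ (mulgI t)); apply: eq_card => v.
  rewrite [RHS]inE; apply/imsetP/eqP => [[u + ->]|fE].
    rewrite inE => /forallP uf; apply/ffunP => x.
    by rewrite ffunE permM tE (eqP (uf x)).
  exists (t^-1 * v)%g; last by rewrite mulKVg.
  rewrite inE; apply/forallP => x.
  by rewrite permM -tE permK [in X in _ == X]fE ffunE.
rewrite (eq_bigr _ solsE) (exchange_big_dep xpredT) //= -cardsT -card_perm -sum1_card.
rewrite [RHS](eq_bigl xpredT); last by move=> t; apply/subsetP => x _; rewrite inE.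
apply: eq_bigr => t _; rewrite (big_pred1 [ffun x => t (f0 x)]) // => f /=.
case: (f =P _) => [->|]; last by rewrite andbF.
rewrite andbT; apply/eqP/fibers_eqP => x y.
by rewrite !ffunE (inj_eq perm_inj).
Qed.

Lemma sum_perm_sols_balanced : #|X| <= #|Y| ->
  \sum_(f : {ffun X -> Y} | [forall b in fibers f, Bal b]) #|perm_sols f| =
  #|Y|`! * stable_count g Bal [set: X].
Proof.
move=> XY; rewrite (partition_big fibers (fun p => [&& partition p [set: X],
    [forall b in p, Bal b] & true])) /=; last first.
  by move=> f ->; rewrite fibersP.
(* Sort the maps by their fibers: unstable fibers contribute nothing, and each stable balanced
   partition contributes [#|Y|!]. *)
rewrite (bigID (fun p : {set {set X}} => [forall b in p, g @: b \in p])) /=.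
rewrite [X in _ + X]big1 ?addn0 => [|p /andP[_ st]]; last first.
  by apply: big1 => f /andP[_ /eqP kf]; rewrite perm_sols0 ?cards0 // kf.
rewrite mulnC -sum_nat_const; apply: eq_big => [p|p /andP[/and3P[pp balp _] st]].
  by rewrite inE /stable_partition andbT andbA.
have [f0 kf0] := fibers_surj XY pp; rewrite -kf0 in balp st *.
rewrite -(sum_perm_sols st); apply: eq_bigl => f.
by case: eqP => [->|]; rewrite ?andbF // balp.
Qed.
End PermCount.

(** * The trace permutation *)

(** In the coordinates (string, offset) the trace permutation adds one to the offset modulo the
    length of the string. The start [off] is kept general for the induction over the strings. *)
Lemma gamma_nat_flatten sh off r c : c < nth 0 sh r ->
  gamma_nat sh off (off + flatten_index sh r c) =
  off + flatten_index sh r (c.+1 %% nth 0 sh r).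
Proof.
rewrite /flatten_index; elim: sh off r => [|a sh IH] off [|r] //= ca.
  rewrite !add0n ltn_add2l ca -addnS eqn_add2l.
  case: eqP => [->|/eqP ne]; first by rewrite modnn addn0.
  by rewrite modn_small // ltn_neqAle ne.
have cs := ca; rewrite -!addnA addnA.
by rewrite ltnNge leq_addr /= IH // !addnA.
Qed.

Definition balanced (s : sparam) (w : seq bool) (b : {set 'I_(size w)}) : bool :=
  eqmod_s s #|[set i in b | nth false w i]| #|[set i in b | ~~ nth false w i]|.

Section Gamma.
Variable l : seq (seq bool).
Local Notation pos := 'I_(size (flatten l)).
Local Notation sh := (shape l).
Local Notation gam := (@gamma l).

Lemma pos_lt (x : pos) : x < sumn sh.
Proof. by rewrite -size_flatten. Qed.

Lemma val_gamma (x : pos) :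
  gam x = flatten_index sh (reshape_index sh x)
    ((reshape_offset sh x).+1 %% nth 0 sh (reshape_index sh x)) :> nat.
Proof.
have xo := reshape_offsetP (pos_lt x).
have gE := gamma_nat_flatten 0 xo; rewrite !add0n reshape_indexK in gE.
rewrite /gamma val_insubd gE ifT // [ltnRHS]size_flatten flatten_indexP //.
by rewrite ltn_pmod //; case: (nth 0 sh _) xo.
Qed.

Lemma index_lt (x : pos) : reshape_index sh x < size l.
Proof. by have := reshape_indexP (pos_lt x); rewrite size_map. Qed.

Definition string_of (x : pos) : 'I_(size l) := Ordinal (index_lt x).

Lemma string_of_gamma x : string_of (gam x) = string_of x.
Proof.
have xo := reshape_offsetP (pos_lt x).
apply: val_inj; rewrite /= val_gamma flatten_indexKl //.
by rewrite ltn_pmod //; case: (nth 0 sh _) xo.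
Qed.

Lemma offset_gamma x : reshape_offset sh (gam x) =
  (reshape_offset sh x).+1 %% nth 0 sh (reshape_index sh x).
Proof.
have xo := reshape_offsetP (pos_lt x).
rewrite val_gamma flatten_indexKr //.
by rewrite ltn_pmod //; case: (nth 0 sh _) xo.
Qed.

Lemma pos_eq (x y : pos) : string_of x = string_of y ->
  reshape_offset sh x = reshape_offset sh y -> x = y.
Proof.
move=> [xy] oxy; apply: val_inj.
by rewrite /= -(reshape_indexK sh x) -(reshape_indexK sh y) xy oxy.
Qed.

Lemma gamma_inj : injective gam.
Proof.
move=> x y E; have xy : string_of x = string_of y.
  by rewrite -string_of_gamma E string_of_gamma.
have ixy : reshape_index sh x = reshape_index sh y by have [] := xy.
have xo := reshape_offsetP (pos_lt x); have yo := reshape_offsetP (pos_lt y).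
apply: pos_eq => //; rewrite ixy in xo; have /eqP := offset_gamma x.
rewrite E offset_gamma ixy -addn1 -[in eqbRHS]addn1 eqn_modDr !modn_small //.
by move/eqP.
Qed.

Lemma iter_gamma m x : string_of (iter m gam x) = string_of x /\
  reshape_offset sh (iter m gam x) =
  (reshape_offset sh x + m) %% nth 0 sh (string_of x).
Proof.
elim: m => [|m [IHi IHo]] /=.
  by rewrite addn0 modn_small // reshape_offsetP ?pos_lt.
rewrite string_of_gamma IHi offset_gamma; split=> //.
have -> : reshape_index sh (iter m gam x) = string_of x by have [] := IHi.
by rewrite IHo -addn1 modnDml addn1 addnS.
Qed.

Lemma string_of_fconnect x y : string_of x = string_of y -> fconnect gam x y.
Proof.
move=> xy; pose k := nth 0 sh (string_of x).
(* The exponent first runs from [x] round to the start of its string, then on to [y]; the natural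
   subtraction is exact because an offset is below the length [k]. *)
suff -> : y = iter (k - reshape_offset sh x + reshape_offset sh y) gam x.
  exact: fconnect_iter.
have [iE oE] := iter_gamma (k - reshape_offset sh x + reshape_offset sh y) x.
apply: pos_eq; first by rewrite iE.
rewrite oE addnA subnKC; last by apply/ltnW/reshape_offsetP/pos_lt.
rewrite modnDl modn_small // /k xy; exact: reshape_offsetP (pos_lt y).
Qed.

Lemma gamma_fiber (S : {set pos}) x y : {in S, forall z, gam z \in S} ->
  x \in S -> string_of x = string_of y -> y \in S.
Proof.
move=> gS xS /string_of_fconnect/iter_findex <-.
by elim: findex => // m IH; apply: gS.
Qed.

Lemma string_of_surj : all (fun e => 0 < size e) l -> forall i, exists x, string_of x = i.
Proof.
move=> l_pos i; have ki : 0 < nth 0 sh i.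
  by rewrite (nth_map [::]) //; apply: (allP l_pos); apply: mem_nth.
have xl : flatten_index sh i 0 < size (flatten l) by rewrite size_flatten flatten_indexP.
by exists (Ordinal xl); apply: val_inj; rewrite /= flatten_indexKl.
Qed.

(** By injectivity [gamma(p)] has as many blocks as [p], so inclusion already gives equality. *)
Lemma perm_partE (p : {set {set pos}}) :
  (perm_part gam p == p) = [forall b in p, gam @: b \in p].
Proof.
rewrite /perm_part eqEcard card_imset ?leqnn ?andbT; last exact: imset_inj gamma_inj.
apply/subsetP/'forall_implyP => [H b bp|H _ /imsetP[b bp ->]]; last exact: H.
by apply: H; apply: imset_f.
Qed.

Lemma same_block_cycle x y :
  same_block (cycle_part gam) x y = fconnect gam x y.
Proof.
have eqv : {in [set: pos] & &, equivalence_rel (fconnect gam)}.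
  move=> a b c _ _ _; rewrite connect0; split=> // ab.
  exact: (same_connect (fconnect_sym gamma_inj) ab).
have part := equivalence_partitionP eqv.
have E z : (z \in pblock (cycle_part gam) x) = fconnect gam x z.
  by rewrite (pblock_equivalence_partition eqv) ?inE.
apply/existsP/idP => [[B /and3P[BP xB yB]]|xy].
  by rewrite -E (def_pblock (partition_trivIset part) BP xB).
exists (pblock (cycle_part gam) x); rewrite !E connect0 xy pblock_mem //.
by rewrite (cover_partition part) inE.
Qed.

(** The sets closed under the relation generating the join are exactly the gamma-stable unions of
    blocks of [p]; the join has one block iff no proper nonempty set is closed. *)
Lemma pjoin_one (p : {set {set pos}}) : 0 < size (flatten l) ->
  partition p [set: pos] ->
  (pjoin p (cycle_part gam) == one_part _) = connected_partition gam [set: pos] p.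
Proof.
move=> k_gt0 pp; rewrite /pjoin.
set E := (fun x y => same_block p x y || _).
have symE : connect_sym E.
  apply: sym_connect_sym => x y; rewrite /E !same_block_cycle fconnect_sym;
    last exact: gamma_inj.
  by congr (_ || _); apply: eq_existsb => b; rewrite [X in _ && X]andbC.
have eqv : {in [set: pos] & &, equivalence_rel (connect E)}.
  move=> a b c _ _ _; rewrite connect0; split=> // ab.
  exact: (same_connect symE ab).
have part := equivalence_partitionP eqv.
have blk z x : (z \in pblock (equivalence_partition (connect E) [set: pos]) x) = connect E x z.
  by rewrite (pblock_equivalence_partition eqv) ?inE.
apply/eqP/connected_partitionP => [one S _ /set0Pn[x xS] gS pS|conn].
  apply/eqP; rewrite eqEsubset subsetT; apply/subsetP => y _.
  have : connect E x y.
    rewrite -blk one /one_part (@def_pblock _ _ [set: pos]) ?inE //.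
    exact: trivIset1.
  have clS : closed E (mem S).
    apply: intro_closed => // u v /orP[/existsP[b /and3P[bp ub vb]] uS|].
      exact: (subsetP (pS _ bp _ ub uS)).
    rewrite same_block_cycle => uv uS; apply: gamma_fiber uS _ => //.
    rewrite -(iter_findex uv); elim: findex => //= m ->.
    by rewrite string_of_gamma.
  by move/(closed_connect clS) => <-.
have full x y : connect E x y.
  suff Ex : [set z | connect E x z] = [set: pos].
    by move/setP/(_ y): Ex; rewrite !inE.
  apply: conn.
  - exact: subsetT.
  - by apply/set0Pn; exists x; rewrite inE.
  - move=> z; rewrite !inE => xz; apply: connect_trans xz (connect1 _).
    by rewrite /E same_block_cycle fconnect1 orbT.
  - move=> b bp z zb; rewrite inE => xz; apply/subsetP => u ub; rewrite inE.
    apply: connect_trans xz (connect1 _); apply/orP; left.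
    by apply/existsP; exists b; rewrite bp zb.
apply/setP => b; rewrite inE; apply/idP/eqP => [bP|->].
  have /set0Pn[x xb] := partition_neq0 part bP.
  rewrite -(def_pblock (partition_trivIset part) bP xb).
  by apply/setP => y; rewrite blk full inE.
(* A point is required here: without positions the join would be the empty partition, whereas
   [one_part] would still contain the empty block. *)
have x0 : pos := Ordinal k_gt0.
suff E0 : pblock (equivalence_partition (connect E) [set: pos]) x0 = [set: pos].
  by rewrite -[X in X \in _]E0 pblock_mem // (cover_partition part) inE.
by apply/setP => y; rewrite blk full inE.
Qed.

Lemma count_partsE s : 0 < size (flatten l) ->
  count_parts s l = connected_count gam (@balanced s (flatten l)) [set: pos].
Proof.
move=> k_gt0; apply: eq_card => p; rewrite !inE /stable_partition.
case pp: (partition p _) => //=; rewrite pjoin_one // perm_partE.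
by rewrite [X in _ && X]andbC andbA.
Qed.

(** * Positions of a sublist of strings inside the full list *)

Section Sub.
Variable B : {set 'I_(size l)}.
Local Notation sh' := (shape (subl B)).
Local Notation pos' := 'I_(size (flatten (subl B))).
Local Notation v := [seq val i | i <- enum B].

Lemma size_subl : size (subl B) = #|B|.
Proof. by rewrite size_map cardE. Qed.

Lemma nth_subl r : r < #|B| -> nth [::] (subl B) r = nth [::] l (nth 0 v r).
Proof.
rewrite cardE => rB; have i0 : 'I_(size l).
  by case: (enum B) rB => [|i _ _] //; exact: i.
by rewrite (nth_map i0) // (nth_map i0) // (tnth_nth [::]).
Qed.

Lemma nth_shape_subl r : r < #|B| -> nth 0 sh' r = nth 0 sh (nth 0 v r).
Proof.
move=> rB; rewrite /shape (nth_map [::]) ?size_subl // nth_subl //.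
have := mem_nth 0 (s := v); rewrite size_map -cardE => /(_ r rB).
by case/mapP => i _ ->; rewrite (nth_map [::]) //; apply: ltn_ord.
Qed.

Lemma sub_index_lt (x : pos') : reshape_index sh' x < #|B|.
Proof.
have /reshape_indexP : x < sumn sh' by rewrite -size_flatten.
by rewrite size_map size_subl.
Qed.

Lemma sub_offset_lt (x : pos') :
  reshape_offset sh' x < nth 0 sh (nth 0 v (reshape_index sh' x)).
Proof.
have /reshape_offsetP : x < sumn sh' by rewrite -size_flatten.
by rewrite nth_shape_subl ?sub_index_lt.
Qed.

Lemma sub_pos_lt (x : pos') : flatten_index sh (nth 0 v (reshape_index sh' x))
  (reshape_offset sh' x) < size (flatten l).
Proof. by rewrite [ltnRHS]size_flatten flatten_indexP // sub_offset_lt. Qed.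

Definition sub_pos (x : pos') : pos := Ordinal (sub_pos_lt x).

Lemma string_of_sub_pos x : string_of (sub_pos x) = nth 0 v (reshape_index sh' x) :> nat.
Proof. by rewrite /= flatten_indexKl // sub_offset_lt. Qed.

Lemma offset_sub_pos x : reshape_offset sh (sub_pos x) = reshape_offset sh' x.
Proof. by rewrite /= flatten_indexKr // sub_offset_lt. Qed.

Lemma nth_sub_pos x : nth false (flatten l) (sub_pos x) = nth false (flatten (subl B)) x.
Proof.
rewrite !nth_flatten offset_sub_pos nth_subl ?sub_index_lt //.
by have := string_of_sub_pos x => /= ->.
Qed.

Lemma sub_pos_inj : injective sub_pos.
Proof.
move=> x y E; have := string_of_sub_pos x; have := offset_sub_pos x.
rewrite E string_of_sub_pos offset_sub_pos => oE /eqP.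
rewrite nth_uniq ?size_map -?cardE ?sub_index_lt //; last first.
  by rewrite map_inj_uniq ?enum_uniq //; apply: val_inj.
move=> /eqP iE; apply: val_inj.
by rewrite /= -(reshape_indexK sh' x) -(reshape_indexK sh' y) iE oE.
Qed.

End Sub.
End Gamma.

(** [sub_pos] preserves offsets and string lengths, and gamma only shifts the offset modulo the
    length. *)
Lemma sub_pos_gamma l (B : {set 'I_(size l)}) (x : 'I_(size (flatten (subl B)))) :
  sub_pos (gamma x) = gamma (sub_pos x).
Proof.
apply: pos_eq.
  apply: ord_inj; rewrite string_of_gamma !string_of_sub_pos.
  by have [->] := string_of_gamma x.
rewrite offset_gamma !offset_sub_pos offset_gamma nth_shape_subl ?sub_index_lt //.
by have := string_of_sub_pos x => /= ->.
Qed.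

Lemma sub_pos_image l (B : {set 'I_(size l)}) :
  (@sub_pos l B) @: [set: 'I_(size (flatten (subl B)))] = @string_of l @^-1: B.
Proof.
apply/setP => y; rewrite inE; apply/imsetP/idP => [[x _ ->]|yB].
  have := mem_nth 0 (s := [seq val i | i <- enum B]).
  rewrite size_map -cardE => /(_ _ (sub_index_lt x)).
  rewrite -string_of_sub_pos mem_map; last exact: val_inj.
  by rewrite mem_enum.
pose r := index (string_of y) (enum B).
have yB' : string_of y \in enum B by rewrite mem_enum.
have rB : r < #|B| by rewrite cardE index_mem.
have vr : nth 0 [seq val i | i <- enum B] r = string_of y.
  by rewrite (nth_map (string_of y)) -?cardE // nth_index.
have ox : reshape_offset (shape l) y < nth 0 (shape (subl B)) r.
  by rewrite nth_shape_subl // vr; apply: reshape_offsetP; rewrite -size_flatten.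
have xl : flatten_index (shape (subl B)) r (reshape_offset (shape l) y) <
    size (flatten (subl B)) by rewrite [ltnRHS]size_flatten flatten_indexP.
exists (Ordinal xl) => //; apply: pos_eq.
  by apply: ord_inj; rewrite string_of_sub_pos /= flatten_indexKl // vr.
by rewrite offset_sub_pos /= flatten_indexKr.
Qed.

Lemma size_flatten_gt0 (l : seq (seq bool)) : 0 < size l ->
  all (fun e => 0 < size e) l -> 0 < size (flatten l).
Proof. by case: l => //= e l _ /andP[e0 _]; rewrite size_cat addn_gt0 e0. Qed.

Lemma all_subl (l : seq (seq bool)) (B : {set 'I_(size l)}) a : all a l -> all a (subl B).
Proof.
move=> /allP H; apply/allP => _ /mapP[i _ ->]; apply: H; exact: mem_tnth.
Qed.

(** [sub_pos] identifies the positions of [subl B] with the positions of [l] on strings in [B],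
    compatibly with gamma and with the letters, so the connected counts agree. *)
Lemma count_parts_subl s l (B : {set 'I_(size l)}) : all (fun e => 0 < size e) l ->
  B != set0 ->
  count_parts s (subl B) =
  connected_count (@gamma l) (@balanced s (flatten l)) (@string_of l @^-1: B).
Proof.
move=> l_pos B0; rewrite count_partsE; last first.
  by rewrite size_flatten_gt0 ?all_subl // size_subl card_gt0.
rewrite -sub_pos_image; apply/esym/connected_count_imset.
- exact: sub_pos_inj.
- exact: sub_pos_gamma.
- move=> b; rewrite /balanced; congr eqmod_s.
    rewrite -(card_imset _ (@sub_pos_inj _ B)); apply: eq_card => y.
    rewrite inE; apply/andP/imsetP => [[/imsetP[x xb ->] yw]|[x + ->]].
      by exists x; rewrite // inE xb -nth_sub_pos.
    by rewrite inE -nth_sub_pos => /andP[xb ->]; rewrite imset_f.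
  rewrite -(card_imset _ (@sub_pos_inj _ B)); apply: eq_card => y.
  rewrite inE; apply/andP/imsetP => [[/imsetP[x xb ->] yw]|[x + ->]].
    by exists x; rewrite // inE xb -nth_sub_pos.
  by rewrite inE -nth_sub_pos => /andP[xb ->]; rewrite imset_f.
Qed.

(** This will be the limiting joint moment of the traces of the strings in [l]. *)
Definition limit_count s l :=
  stable_count (@gamma l) (@balanced s (flatten l)) [set: 'I_(size (flatten l))].

(** This is the moment-cumulant formula with [count_parts] in the role of the cumulants. *)
Lemma limit_count_sum s l : all (fun e => 0 < size e) l ->
  limit_count s l =
  \sum_(P : {set {set 'I_(size l)}} | partition P [set: 'I_(size l)])
     \prod_(B in P) count_parts s (subl B).
Proof.
move=> l_pos; rewrite /limit_count.
rewrite (stable_count_sum _ (string_of_surj l_pos) (@string_of_gamma l) (@gamma_fiber l)).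
apply: eq_bigr => P PP; apply: eq_bigr => B BP.
by rewrite count_parts_subl ?(partition_neq0 PP).
Qed.

Import GRing.Theory.

(** * Products of traces *)

Lemma gamma_nat_shift sh off j : j < sumn sh ->
  gamma_nat sh off (off + j) = off + gamma_nat sh 0 j.
Proof.
move=> js; have := gamma_nat_flatten off (reshape_offsetP js).
have := gamma_nat_flatten 0 (reshape_offsetP js).
by rewrite !add0n !reshape_indexK => -> ->.
Qed.

Section Traces.
Local Open Scope ring_scope.
Variables (K : comNzRingType) (n : nat) (M : bool -> 'M[K]_n.+1).
Local Notation T := 'I_n.+1.

Lemma sum_tuple_cons m (F : seq T -> K) :
  \sum_(t : m.+1.-tuple T) F t = \sum_(x : T) \sum_(t : m.-tuple T) F (x :: t).
Proof.
rewrite pair_big /= (reindex (fun p : T * m.-tuple T => [tuple of p.1 :: p.2])) //=.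
exists (fun t : m.+1.-tuple T => (thead t, [tuple of behead t])) => [[x t] _|t _] /=.
  by congr (_, _); apply: val_inj.
by rewrite [RHS]tuple_eta.
Qed.

Lemma sum_tuple_cat a b (F : seq T -> K) :
  \sum_(t : (a + b).-tuple T) F t =
  \sum_(u : a.-tuple T) \sum_(v : b.-tuple T) F (u ++ v).
Proof.
elim: a F => [|a IH] F.
  rewrite (big_pred1 [tuple]) // => t; apply/esym/eqP; exact: tuple0.
rewrite (sum_tuple_cons _ (fun u => \sum_(v : b.-tuple T) F (u ++ v))).
rewrite (sum_tuple_cons (a + b)).
by apply: eq_bigr => x _; rewrite (IH (fun t => F (x :: t))).
Qed.

Definition word_mx (e : seq bool) : 'M[K]_n.+1 := foldr (fun c A => M c *m A) 1%:M e.

(** The default value [b] of [nth] supplies the endpoint of the path: the last letter reads one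
    place beyond the end of [t]. *)
Definition path_weight (e : seq bool) (t : seq T) (b : T) : K :=
  \prod_(i < size e) M (nth false e i) (nth b t i) (nth b t i.+1).

Lemma path_weight_cons c e x t b :
  path_weight (c :: e) (x :: t) b = M c x (nth b t 0) * path_weight e t b.
Proof. exact: big_ord_recl. Qed.

Lemma word_mxE c e a b :
  word_mx (c :: e) a b = \sum_(t : (size e).-tuple T) path_weight (c :: e) (a :: t) b.
Proof.
elim: e c a => [|c' e IH] c a.
  rewrite /word_mx /= mulmx1 (big_pred1 [tuple]) => [|t]; last by apply/esym/eqP/tuple0.
  by rewrite path_weight_cons /= /path_weight big_ord0 mulr1.
rewrite [LHS]mxE (sum_tuple_cons _ (fun t => path_weight [:: c, c' & e] (a :: t) b)).
apply: eq_bigr => x _; rewrite [X in _ * X]IH mulr_sumr; apply: eq_bigr => t _.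
by rewrite [in RHS]path_weight_cons.
Qed.

Lemma trace_word_mx e : (0 < size e)%N -> \tr (word_mx e) =
  \sum_(t : (size e).-tuple T) \prod_(i < size e)
    M (nth false e i) (nth ord0 t i)
      (nth ord0 t (if i.+1 == size e then 0 else i.+1)).
Proof.
case: e => // c e _; rewrite /mxtrace.
rewrite (sum_tuple_cons (size e) (fun t => \prod_(i < size (c :: e))
    M (nth false (c :: e) i) (nth ord0 t i)
      (nth ord0 t (if i.+1 == size (c :: e) then 0 else i.+1)))).
apply: eq_bigr => a _; rewrite word_mxE; apply: eq_bigr => t _.
apply: eq_bigr => i _; congr (M _ _ _).
  by apply: set_nth_default; rewrite /= size_tuple.
(* On the diagonal the endpoint [b] is the starting index [a], which is what the cyclic index 0
   returns at the last letter. *)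
case: eqP => [->|/eqP ne] /=; first by rewrite nth_default ?size_tuple.
apply: set_nth_default; rewrite size_tuple -ltnS ltn_neqAle ne; exact: ltn_ord.
Qed.

(** Gamma closes each string on itself, so when the index tuple is cut after the first string, the
    weight factors into the weight of that string and the weight of the rest. *)
Lemma prod_trace_tuple l : all (fun e => 0 < size e)%N l ->
  \prod_(e <- l) \tr (word_mx e) =
  \sum_(t : (size (flatten l)).-tuple T) \prod_(i < size (flatten l))
    M (nth false (flatten l) i) (nth ord0 t i)
      (nth ord0 t (gamma_nat (shape l) 0 i)).
Proof.
elim: l => [_|e l IH /= /andP[e0 l_pos]].
  rewrite big_nil (big_pred1 [tuple]) => [|t]; last by apply/esym/eqP/tuple0.
  by rewrite big_ord0.
rewrite big_cons IH // trace_word_mx // size_cat.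
rewrite (sum_tuple_cat _ _ (fun t => \prod_(i < size e + size (flatten l))
  M (nth false (e ++ flatten l) i) (nth ord0 t i)
    (nth ord0 t (if (i < 0 + size e)%N then if i.+1 == (0 + size e)%N then 0%N else i.+1
                 else gamma_nat (shape l) (0 + size e) i)))).
rewrite big_distrlr; apply: eq_bigr => u _; apply: eq_bigr => v _.
rewrite big_split_ord /=; congr (_ * _); apply: eq_bigr => i _; congr (M _ _ _).
- by rewrite nth_cat ltn_ord.
- by rewrite nth_cat size_tuple ltn_ord.
- rewrite add0n ltn_ord nth_cat size_tuple.
  by case: eqP => [_|/eqP ne]; rewrite ?e0 // ltn_neqAle ne ltn_ord.
- by rewrite nth_cat ltnNge leq_addr addKn.
- by rewrite nth_cat size_tuple ltnNge leq_addr addKn.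
- rewrite add0n ltnNge leq_addr /= gamma_nat_shift -?size_flatten //.
  by rewrite nth_cat size_tuple ltnNge leq_addr addKn.
Qed.

Lemma prod_trace l : all (fun e => 0 < size e)%N l ->
  \prod_(e <- l) \tr (word_mx e) =
  \sum_(f : {ffun 'I_(size (flatten l)) -> T}) \prod_(x < size (flatten l))
    M (nth false (flatten l) x) (f x) (f (gamma x)).
Proof.
move=> l_pos; rewrite prod_trace_tuple //.
rewrite (reindex (@tuple_of_finfun T _)) /=; last first.
  exists (@finfun_of_tuple T _) => f _; [exact: tuple_of_finfunK|exact: finfun_of_tupleK].
have nthE (f : {ffun 'I_(size (flatten l)) -> T}) (x : 'I_(size (flatten l))) :
    nth ord0 (tuple_of_finfun f) x = f x.
  by rewrite -tnth_nth -[in RHS](tuple_of_finfunK f) ffunE.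
apply: eq_bigr => f _; apply: eq_bigr => x _; rewrite nthE -[f (gamma x)]nthE.
congr (M _ _ (nth _ _ _)).
have xs : (x < sumn (shape l))%N by exact: pos_lt.
have := gamma_nat_flatten 0 (reshape_offsetP xs).
by rewrite !add0n reshape_indexK val_gamma.
Qed.

End Traces.

From mathcomp Require Import reals complex.

(** * Cumulants *)

Section Cumulant.
Variables (R : realType) (s : sparam).
Local Open Scope ring_scope.

Lemma subl_setT (X : Type) (l : seq X) : subl [set: 'I_(size l)] = l.
Proof.
rewrite /subl; have -> : enum [set: 'I_(size l)] = enum 'I_(size l).
  by apply: eq_enum => i; rewrite !inE.
exact: map_tnth_enum (in_tuple l).
Qed.

Lemma partition_setT (I : finType) (i : I) : partition [set [set: I]] [set: I].
Proof.
apply/and3P; split; [by rewrite /cover big_set1|exact: trivIset1|].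
by rewrite inE eq_sym; apply/set0Pn; exists i; rewrite inE.
Qed.

Lemma partition_setTP (I : finType) (P : {set {set I}}) (B : {set I}) :
  partition P [set: I] -> B \in P -> B = [set: I] -> P = [set [set: I]].
Proof.
move=> PP BP BT; apply/setP => C; rewrite inE; apply/idP/eqP => [CP|->]; last by rewrite -BT.
have /set0Pn[x xC] := partition_neq0 PP CP.
have tP := partition_trivIset PP.
by rewrite -(def_pblock tP CP xC) (def_pblock tP BP) // BT inE.
Qed.

(** Subtracting from [limit_count_sum] all terms but the one-block partition leaves [count_parts].
    Every block of another partition is a proper subset, so the shorter sublist stays within the
    remaining fuel. *)
Lemma cum_aux_count (m : seq (seq bool) -> R[i]) :
  (forall l, all (fun e => 0 < size e)%N l -> m l = (limit_count s l)%:R) ->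
  forall f l, (0 < size l <= f)%N -> all (fun e => 0 < size e)%N l ->
    cum_aux m f l = (count_parts s l)%:R.
Proof.
move=> mE; elim=> [|f IH] l /andP[l0 lf] l_pos; first by case: (size l) l0 lf.
rewrite /= mE // limit_count_sum //.
rewrite (bigD1 [set [set: 'I_(size l)]]) /=; last exact: partition_setT (Ordinal l0).
rewrite big_set1 natrD subl_setT natr_sum.
rewrite [X in _ - X](_ : _ = \sum_(P | partition P [set: 'I_(size l)] &&
    (P != [set [set: 'I_(size l)]])) (\prod_(B in P) count_parts s (subl B))%:R).
  by rewrite addrK.
apply: eq_bigr => P /andP[PP PT]; rewrite natr_prod; apply: eq_bigr => B BP.
apply: IH; last exact: all_subl.
rewrite size_subl card_gt0 (partition_neq0 PP BP) -ltnS; apply: leq_trans lf.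
rewrite -[X in (_ < X)%N]card_ord -cardsT; apply: proper_card.
rewrite properT; apply: contraNneq PT => BT.
by rewrite (partition_setTP PP BP BT).
Qed.
End Cumulant.

From mathcomp Require Import all_classical all_reals all_analysis.
From mathcomp Require Import ring lra.
Import Order.TTheory GRing.Theory Num.Theory numFieldNormedType.Exports.
Local Open Scope ring_scope.
Local Open Scope complex_scope.

(** * Averages over the torus *)

Section Integrals.
Variable R : realType.
Local Notation mu := (@lebesgue_measure R).
Implicit Types (c t : R).

Lemma continuous_scale c (f : R -> R) : continuous f -> continuous (fun t => c * f t).
Proof.
by move=> cf t; apply: (@continuous_comp _ _ _ f ( *%R c));
  [exact: cf|exact: mulrl_continuous].
Qed.

Lemma continuous_cosZ c : continuous (fun t => cos (c * t)).
Proof.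
move=> t; apply: (@continuous_comp _ _ _ ( *%R c) (@cos R)); first exact: mulrl_continuous.
exact: continuous_cos.
Qed.

Lemma continuous_sinZ c : continuous (fun t => sin (c * t)).
Proof.
move=> t; apply: (@continuous_comp _ _ _ ( *%R c) (@sin R)); first exact: mulrl_continuous.
exact: continuous_sin.
Qed.

Lemma Rintegral01_derive (F f : R -> R) : continuous F -> continuous f ->
  (forall t, is_derive t (1 : R) F (f t)) ->
  Rintegral mu `[0%R, 1%R]%classic f = F 1 - F 0.
Proof.
move=> cF cf dF; rewrite /Rintegral (@continuous_FTC2 _ f F) //.
- by apply: continuous_subspaceT.
- split.
  + by move=> t _; have [] := dF t.
  + by apply: cvg_at_right_filter; apply: cF.
  + by apply: cvg_at_left_filter; apply: cF.
- by move=> t _; rewrite derive1E; have [_ ->] := dF t.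
Qed.

Lemma Rintegral01_cosZ c : c != 0 ->
  Rintegral mu `[0%R, 1%R]%classic (fun t => cos (c * t)) = c^-1 * sin c.
Proof.
move=> c0; rewrite (@Rintegral01_derive (fun t => c^-1 * sin (c * t))
  (fun t => cos (c * t)) _ _ _).
- by rewrite mulr1 mulr0 sin0 mulr0 subr0.
- exact/continuous_scale/continuous_sinZ.
- exact: continuous_cosZ.
- move=> t; have dc : is_derive t (1 : R) ( *%R c) c.
    by apply: is_derive_eq; rewrite /GRing.scale /= mulr1.
  have ds := is_derive1_comp (is_derive_sin (c * t)) dc.
  apply: (is_derive_eq (is_deriveZ c^-1 ds)).
  by rewrite /GRing.scale /= mulrCA mulVf // mulr1.
Qed.

Lemma Rintegral01_sinZ c : c != 0 ->
  Rintegral mu `[0%R, 1%R]%classic (fun t => sin (c * t)) = c^-1 * (1 - cos c).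
Proof.
move=> c0; rewrite (@Rintegral01_derive (fun t => (- c^-1) * cos (c * t))
  (fun t => sin (c * t)) _ _ _).
- by rewrite mulr1 mulr0 cos0; ring.
- exact/continuous_scale/continuous_cosZ.
- exact: continuous_sinZ.
- move=> t; have dc : is_derive t (1 : R) ( *%R c) c.
    by apply: is_derive_eq; rewrite /GRing.scale /= mulr1.
  have ds := is_derive1_comp (is_derive_cos (c * t)) dc.
  apply: (is_derive_eq (is_deriveZ (- c^-1) ds)).
  by rewrite /GRing.scale /= mulrA mulrNN mulrAC mulVf // mul1r.
Qed.

Definition cis (x : R) : R[i] := cos x +i* sin x.

Lemma cis0 : cis 0 = 1.
Proof. by rewrite /cis cos0 sin0. Qed.

Lemma cisD x y : cis (x + y) = cis x * cis y.
Proof. by rewrite /cis cosD sinD; simpc; rewrite [sin x * _ + _]addrC. Qed.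

Lemma conjc_cis x : conjc (cis x) = cis (- x).
Proof. by rewrite /cis cosN sinN. Qed.

Lemma cisX x m : cis x ^+ m = cis (m%:R * x).
Proof.
elim: m => [|m IH]; first by rewrite expr0 mul0r cis0.
by rewrite exprS IH -cisD mulrS mulrDl mul1r.
Qed.

Lemma expi2piE t : expi2pi t = cis (2 * pi * t).
Proof. by []. Qed.

Definition zpow (a b : nat) (z : R[i]) : R[i] := z ^+ a * conjc z ^+ b.

Lemma zpow_expi2pi a b t :
  zpow a b (expi2pi t) = cis ((a%:R - b%:R) * (2 * pi) * t).
Proof.
rewrite /zpow expi2piE conjc_cis !cisX -cisD; congr cis.
by rewrite mulrN -mulrBl mulrA.
Qed.

(** Continuity travels with the value of the integral, so that integrability is at hand whenever
    integrals are added or scaled. *)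
Definition Cint01_is (h : R -> R[i]) (v : R[i]) : Prop :=
  [/\ continuous (fun t => complex.Re (h t)), continuous (fun t => complex.Im (h t))
    & Cint01 h = v].

Lemma continuous_integrable01 (f : R -> R) : continuous f ->
  mu.-integrable `[0%R, 1%R]%classic (EFin \o f).
Proof.
move=> cf; apply: continuous_compact_integrable; first exact: segment_compact.
exact: continuous_subspaceT.
Qed.

Lemma Cint01_is0 : Cint01_is (fun=> 0) 0.
Proof.
split; [exact: cst_continuous|exact: cst_continuous|].
by rewrite /Cint01 /= Rintegral_cst ?mul0r.
Qed.

Lemma Cint01_isD h1 v1 h2 v2 : Cint01_is h1 v1 -> Cint01_is h2 v2 ->
  Cint01_is (fun t => h1 t + h2 t) (v1 + v2).
Proof.
move=> [cr1 ci1 <-] [cr2 ci2 <-].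
have rE : (fun t => complex.Re (h1 t + h2 t)) =
    (fun t => complex.Re (h1 t) + complex.Re (h2 t)).
  by apply: funext => t; case: (h1 t) (h2 t) => ? ? [].
have iE : (fun t => complex.Im (h1 t + h2 t)) =
    (fun t => complex.Im (h1 t) + complex.Im (h2 t)).
  by apply: funext => t; case: (h1 t) (h2 t) => ? ? [].
split.
- by rewrite rE => t; apply: continuousD; [exact: cr1|exact: cr2].
- by rewrite iE => t; apply: continuousD; [exact: ci1|exact: ci2].
by rewrite /Cint01 rE iE !RintegralD //; exact: continuous_integrable01.
Qed.

Lemma Cint01_isZ h v d : Cint01_is h v -> Cint01_is (fun t => d * h t) (d * v).
Proof.
move=> [cr ci <-]; case: d => x y.
have rE : (fun t => complex.Re ((x +i* y) * h t)) =
    (fun t => x * complex.Re (h t) - y * complex.Im (h t)).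
  by apply: funext => t; case: (h t).
have iE : (fun t => complex.Im ((x +i* y) * h t)) =
    (fun t => x * complex.Im (h t) + y * complex.Re (h t)).
  by apply: funext => t; case: (h t).
split.
- by rewrite rE => t; apply: cvgB; apply: continuous_scale.
- by rewrite iE => t; apply: cvgD; apply: continuous_scale.
rewrite /Cint01 rE iE RintegralB ?RintegralD //;
  try exact/continuous_integrable01/continuous_scale.
by rewrite !RintegralZl //; exact: continuous_integrable01.
Qed.

Lemma Cint01_is_sum (X : Type) (r : seq X) (h : X -> R -> R[i]) v :
  (forall x, Cint01_is (h x) (v x)) ->
  Cint01_is (fun t => \sum_(x <- r) h x t) (\sum_(x <- r) v x).
Proof.
move=> hv; elim: r => [|x r IH].
  by under eq_fun do rewrite big_nil; rewrite big_nil; exact: Cint01_is0.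
under eq_fun do rewrite big_cons; rewrite big_cons.
exact: Cint01_isD (hv x) IH.
Qed.

Lemma expi2pi1 : expi2pi 1 = 1 :> R[i].
Proof. by rewrite /expi2pi mulr1 mulr_natl cos2pi sin2pi. Qed.

Lemma Cint01_zpow a b :
  Cint01_is (fun t => zpow a b (expi2pi t)) (a == b)%:R.
Proof.
pose c : R := (a%:R - b%:R) * (2 * pi).
have E : (fun t => zpow a b (expi2pi t)) = fun t => cis (c * t).
  by apply: funext => t; rewrite zpow_expi2pi.
rewrite E; split; [exact: continuous_cosZ|exact: continuous_sinZ|].
case: eqP => [ab|/eqP ab].
  have c0 : c = 0 by rewrite /c ab subrr mul0r.
  rewrite /Cint01 /= c0; under eq_Rintegral do rewrite mul0r cos0.
  under [X in _ +i* X]eq_Rintegral do rewrite mul0r sin0.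
  by rewrite !Rintegral_cst //= lebesgue_measure_itv /= lte01 oppr0 adde0 mul0r mulr1.
have c0 : c != 0.
  rewrite mulf_neq0 ?subr_eq0 ?eqr_nat // mulf_neq0 ?pnatr_eq0 //.
  by rewrite gt_eqF // pi_gt0.
(* The frequency [c] is an integer multiple of [2 * pi], as seen by evaluating at [t = 1]; so the
   primitives agree at both ends and the integral vanishes. *)
have c1 : cis c = 1.
  have := zpow_expi2pi a b 1; rewrite expi2pi1 mulr1 -/c => <-.
  by rewrite /zpow rmorph1 !expr1n mulr1.
have [cc sc] : cos c = 1 /\ sin c = 0 by case: c1.
by rewrite /Cint01 /= Rintegral01_cosZ // Rintegral01_sinZ // cc sc subrr !mulr0.
Qed.

End Integrals.

Section Torus.
Variable R : realType.
Local Notation C := R[i].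

(** If [cos x = 1], the half-angle formula forces [sin (x / 2) = 0], impossible for [x / 2] strictly
    between 0 and [pi]. *)
Lemma cis_neq1 (x : R) : 0 < x < 2 * pi -> cis x != 1.
Proof.
move=> /andP[x0 x2]; apply/eqP => -[cx _].
have sx : 0 < sin (x / 2).
  by apply: sin_gt0_pi; rewrite divr_gt0 //= ltr_pdivrMr // mulrC.
have : cos (x / 2 *+ 2) = 1 by rewrite -mulr_natr divfK ?pnatr_eq0.
rewrite cos_mulr2n cos2sin2 => E.
have : sin (x / 2) ^+ 2 = 0 by lra.
by move/eqP; rewrite sqrf_eq0 gt_eqF.
Qed.

Lemma expi2pi_ratio m k : expi2pi (k%:R / m%:R) = expi2pi (m%:R^-1) ^+ k :> C.
Proof. by rewrite !expi2piE cisX; congr cis; ring. Qed.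

Lemma prim_expi2pi m : (0 < m)%N -> m.-primitive_root (expi2pi (m%:R^-1) : C).
Proof.
move=> m0; have mR : 0 < m%:R :> R by rewrite ltr0n.
rewrite /primitive_root_of_unity m0 /=; apply/forallP => k; rewrite unity_rootE -expi2pi_ratio.
case: (k.+1 =P m) => [->|/eqP km]; first by rewrite divff ?lt0r_neq0 // expi2pi1 eqxx.
have km' : (k.+1 < m)%N by rewrite ltn_neqAle km ltn_ord.
suff /negPf -> : expi2pi (k.+1%:R / m%:R) != 1 :> C by [].
have pi2 : 0 < 2 * pi :> R by rewrite mulr_gt0 ?pi_gt0.
rewrite expi2piE cis_neq1 //; apply/andP; split.
  by rewrite mulr_gt0 // divr_gt0 ?ltr0n.
by rewrite gtr_pMr // ltr_pdivrMr // mul1r ltr_nat.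
Qed.

Lemma zpowX a b (z : C) t : zpow a b (z ^+ t) = zpow a b z ^+ t.
Proof. by rewrite /zpow rmorphXn exprMn -!exprM ![(t * _)%N]mulnC. Qed.

Lemma zpow_unit_eq1 a b (t : R) (z := expi2pi t) : (zpow a b z == 1) = (z ^+ a == z ^+ b).
Proof.
have zz : z * conjc z = 1 by rewrite /z expi2piE conjc_cis -cisD subrr cis0.
have zb : z ^+ b * conjc z ^+ b = 1 by rewrite -exprMn zz expr1n.
have zb0 : conjc z ^+ b != 0.
  by apply: contraTneq (oner_neq0 C) => z0; rewrite -zb z0 mulr0 eqxx.
by rewrite -[in LHS]zb /zpow (inj_eq (mulIf zb0)).
Qed.

(** The summands are the powers of one root of unity [q] with [q ^+ m = 1]: the geometric sum is [m]
    if [q = 1] and 0 otherwise. Primitivity turns [q = 1] into the congruence of [a] and [b]. *)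
Lemma mean_zpow m a b : (0 < m)%N ->
  m%:R^-1 * \sum_(t < m) zpow a b (expi2pi ((t : nat)%:R / m%:R)) =
  (a == b %[mod m])%:R :> C.
Proof.
move=> m0; have prim := prim_expi2pi m0.
have mC : m%:R != 0 :> C by rewrite pnatr_eq0 -lt0n.
under eq_bigr do rewrite expi2pi_ratio zpowX.
rewrite -(eq_prim_root_expr prim) -zpow_unit_eq1.
set q := zpow a b _.
have qm : q ^+ m = 1 by rewrite /q -zpowX (prim_expr_order prim) /zpow rmorph1 !expr1n mulr1.
case: eqP => [->|/eqP q1].
  under eq_bigr do rewrite expr1n.
  by rewrite sumr_const card_ord mulVf.
have := subrX1 q m; rewrite qm subrr => /esym/eqP.
by rewrite mulf_eq0 subr_eq0 (negPf q1) /= => /eqP ->; rewrite mulr0.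
Qed.

Section Sum.
Variables (n : nat) (X : finType) (c : X -> C) (a b : X -> 'I_n -> nat).

(** Each integrated coordinate turns its monomial into the indicator of equal exponents. Since [l]
    is duplicate-free, the monomial in coordinate [i] is still intact when its turn comes. *)
Lemma int_coords_sum (l : seq 'I_n) (th : 'I_n -> R) : uniq l ->
  int_coords l (fun th => \sum_x c x * \prod_i zpow (a x i) (b x i) (expi2pi (th i))) th =
  \sum_x c x * \prod_i (if i \in l then (a x i == b x i)%:R
                        else zpow (a x i) (b x i) (expi2pi (th i))).
Proof.
elim: l th => [|i l IH] th /=; first by [].
move=> /andP[il ul]; pose v x := c x * \prod_(j | j != i)
  (if j \in l then (a x j == b x j)%:R else zpow (a x j) (b x j) (expi2pi (th j))).
have -> : (fun t => int_coords l (fun th => \sum_x c x * \prod_i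
      zpow (a x i) (b x i) (expi2pi (th i))) (fun j => if j == i then t else th j)) =
    (fun t => \sum_x v x * zpow (a x i) (b x i) (expi2pi t)).
  apply: funext => t; rewrite IH //; apply: eq_bigr => x _.
  rewrite (bigD1 i) //= (negPf il) eqxx /v -mulrA; congr (_ * _).
  rewrite [RHS]mulrC; congr (_ * _).
  by apply: eq_bigr => j ji; rewrite (negPf ji).
have [_ _ ->] : Cint01_is (fun t => \sum_x v x * zpow (a x i) (b x i) (expi2pi t))
    (\sum_x v x * (a x i == b x i)%:R).
  by apply: Cint01_is_sum => x; apply/Cint01_isZ/Cint01_zpow.
apply: eq_bigr => x _; rewrite [in RHS](bigD1 i) //= mem_head mulrCA mulrC.
congr (_ * _); rewrite /v; congr (_ * _); apply: eq_bigr => j ji.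
by rewrite in_cons (negPf ji).
Qed.

Lemma torusE_sum s : sparam_ok s ->
  torusE s (fun z => \sum_x c x * \prod_i zpow (a x i) (b x i) (z i)) =
  \sum_x c x * \prod_i (eqmod_s s (a x i) (b x i))%:R.
Proof.
case: s => [m /= m2|_] /=; last first.
  rewrite int_coords_sum ?enum_uniq //; apply: eq_bigr => x _; congr (_ * _).
  by apply: eq_bigr => i _; rewrite mem_enum.
rewrite exchange_big mulr_sumr; apply: eq_bigr => x _.
rewrite -mulr_sumr mulrCA; congr (_ * _).
(* The sum over all choices of roots factors into one sum per coordinate, and the normalisation
   [m ^ n] gives each of them a factor [m]. *)
rewrite -(bigA_distr_bigA (fun i (t : 'I_m) =>
  zpow (a x i) (b x i) (expi2pi ((t : nat)%:R / m%:R)))) /=.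
have -> : (m ^ n)%N%:R^-1 = \prod_(i < n) (m%:R^-1 : C).
  by rewrite prodr_const card_ord natrX exprVn.
rewrite -big_split /=; apply: eq_bigr => i _.
by rewrite mean_zpow // ltnW.
Qed.

End Sum.
End Torus.

(** * Moments *)

Section Moments.
Variables (R : realType) (s : sparam) (l : seq (seq bool)).
Hypothesis s_ok : sparam_ok s.
Hypothesis l_pos : all (fun e => 0 < size e)%N l.
Local Notation C := R[i].
Local Notation k := (size (flatten l)).
Local Notation w := (flatten l).

Section Size.
Variable n : nat.
Local Notation T := 'I_n.+1.
Implicit Types (f : {ffun 'I_k -> T}) (sg : 'S_n.+1) (z : T -> C).

Definition multiplicity (c : bool) f (v : T) : nat :=
  #|[set x : 'I_k | (f x == v) && (nth false w x == c)]|.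

(** The factor at position [x] vanishes unless [sg (f (gamma x)) = f x], which yields the indicator
    of [perm_sols]; the surviving entries are then collected by the value of [f]. *)
Lemma prod_TrW_monomial sg z :
  \prod_(e <- l) TrW e (monomial_mx sg z) =
  \sum_f (sg \in perm_sols (@gamma l) f)%:R *
     \prod_v zpow (multiplicity true f v) (multiplicity false f v) (z v).
Proof.
have := prod_trace (fun c => vpow (monomial_mx sg z) c) l_pos; rewrite /word_mx => ->.
apply: eq_bigr => f _; rewrite inE.
have vpowE c (i j : T) : vpow (monomial_mx sg z) c i j =
    (sg j == i)%:R * (if c then z i else conjc (z i)).
  case: c; rewrite /vpow !mxE; case: eqP => _; rewrite ?mul1r ?mul0r //.
  exact: rmorph0.
under [LHS]eq_bigr do rewrite vpowE.
rewrite big_split /=; congr (_ * _).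
  case: forallP => [H|H]; first by rewrite big1 // => x _; rewrite H.
  have /existsP[x xf] : [exists x, sg (f (gamma x)) != f x].
    by rewrite -negb_forall; apply/forallP.
  by rewrite (bigD1 x) //= (negPf xf) mul0r.
rewrite (partition_big f xpredT) //=; apply: eq_bigr => v _.
rewrite (bigID (fun x : 'I_k => nth false w x)) /= /zpow; congr (_ * _).
  rewrite (eq_bigr (fun=> z v)); last by move=> x /andP[/eqP -> ->].
  rewrite prodr_const; congr (_ ^+ _); apply: eq_card => x.
  by rewrite !inE unfold_in /=; case: nth.
rewrite (eq_bigr (fun=> conjc (z v))); last by move=> x /andP[/eqP -> /negPf ->].
rewrite prodr_const; congr (_ ^+ _); apply: eq_card => x.
by rewrite !inE unfold_in /=; case: nth.
Qed.

Lemma balanced_fibers f :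
  [forall b in fibers f, balanced s b] =
  [forall v, eqmod_s s (multiplicity true f v) (multiplicity false f v)].
Proof.
have blkE v x : f x = v ->
    balanced s [set y | f x == f y] =
    eqmod_s s (multiplicity true f v) (multiplicity false f v).
  move=> <-; rewrite /balanced /multiplicity; congr eqmod_s; apply: eq_card => y.
    by rewrite !inE eq_sym eqb_id.
  by rewrite !inE eq_sym; case: nth.
apply/'forall_implyP/forallP => [H v|H b bk].
  have [/existsP[x /eqP xv]|/existsPn nv] := boolP [exists x, f x == v].
    by rewrite -(blkE v x xv) H // fibers_block.
  (* A value that [f] does not take has both multiplicities 0 and is balanced trivially. *)
  suff m0 c : multiplicity c f v = 0 by rewrite !m0; case: s => //= m; rewrite eqxx.
  apply: eq_card0 => x; rewrite !inE (negPf (nv x)) //.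
have /set0Pn[x xb] := partition_neq0 (fibersP f) bk.
suff -> : b = [set y | f x == f y] by rewrite (blkE _ x erefl).
by apply/setP => y; rewrite inE (mem_fibers _ bk xb).
Qed.

Lemma momentE : (k <= n.+1)%N -> moment R s n.+1 l = (limit_count s l)%:R.
Proof.
move=> kn; rewrite /moment /haarE.
have nC : n.+1`!%:R != 0 :> C by rewrite pnatr_eq0 -lt0n fact_gt0.
apply: (mulfI nC); rewrite mulVKf // -natrM.
have := @sum_perm_sols_balanced _ T _ (@balanced s w) (@gamma_inj l).
rewrite !card_ord => /(_ kn) <-.
rewrite natr_sum.
(* For fixed [sg], averaging over the diagonal part keeps exactly the maps with balanced fibers. *)
transitivity (\sum_(sg : 'S_n.+1) \sum_(f : {ffun 'I_k -> T})
   (sg \in perm_sols (@gamma l) f)%:R * [forall b in fibers f, balanced s b]%:R : C).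
  apply: eq_bigr => sg _.
  have -> : (fun z => \prod_(e <- l) TrW e (monomial_mx sg z)) =
      (fun z => \sum_f (sg \in perm_sols (@gamma l) f)%:R *
         \prod_v zpow (multiplicity true f v) (multiplicity false f v) (z v)).
    by apply: funext => z; rewrite prod_TrW_monomial.
  rewrite torusE_sum //; apply: eq_bigr => f _; congr (_ * _).
  rewrite balanced_fibers; case: forallP => [H|H].
    by rewrite big1 // => v _; rewrite H.
  have /existsP[v vf] : [exists v, ~~ eqmod_s s (multiplicity true f v)
      (multiplicity false f v)].
    by rewrite -negb_forall; apply/forallP.
  by rewrite (bigD1 v) //= (negPf vf) mul0r.
(* For fixed [f], summing the indicator over all permutations gives [#|perm_sols f|]. *)
rewrite exchange_big [RHS]big_mkcond; apply: eq_bigr => f _.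
rewrite -mulr_suml -natr_sum; case: ifP => _; rewrite ?mulr0 // mulr1.
by rewrite -sum1_card [in RHS]big_mkcond.
Qed.

End Size.

(** The sequence is eventually constant by [momentE]; the threshold [k.+1] also discards [n = 0],
    which is not of the form [n.+1]. *)
Lemma cvgC_moment : cvgC (fun n => moment R s n l) (limit_count s l)%:R.
Proof.
by split; apply: cvg_near_cst; exists k.+1 => // -[//|n] /= kn; rewrite momentE // ltnW.
Qed.

End Moments.

Theorem theorem8p3 (R : realType) (s : sparam) (strs : seq (seq bool)) :
  sparam_ok s -> (0 < size strs)%N -> all (fun e => 0 < size e)%N strs ->
  exists m : seq (seq bool) -> R[i],
    (forall l : seq (seq bool), all (fun e => 0 < size e)%N l ->
       cvgC (fun n => moment R s n l) (m l)) /\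
    cumulant m strs = (count_parts s strs)%:R.
Proof.
move=> s_ok r_gt0 strs_pos; exists (fun l => (limit_count s l)%:R); split.
  by move=> l l_pos; apply: cvgC_moment.
by apply: (@cum_aux_count R s) => //; rewrite r_gt0 leqnn.
Qed.
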